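(* There exists a translation invariant ideal $\mathcal{I}$ on $\mathbb{N}$ for which there is a rich translation invariant abstract upper density $\delta$ with $\mathcal{Z}_\delta=\mathcal{I}$, but there is no $\mathcal{I}$-TAD family of cardinality $\mathfrak{c}$.
   Context: For $A\subseteq\mathbb{N}$ and $k\in\mathbb{Z}$, $A+k$ denotes $\{a+k:a\in A\}\cap\mathbb{N}$. An abstract upper density on $\mathbb{N}$ is a function $\delta:\mathcal{P}(\mathbb{N})\to[0,1]$ such that $\delta(\mathbb{N})=1$; $\delta(F)=0$ for every finite $F\subseteq\mathbb{N}$; $A\subseteq B$ implies $\delta(A)\le\delta(B)$; and $\delta(A\cup B)\le\delta(A)+\delta(B)$. It is translation invariant if $\delta(A+k)=\delta(A)$ for all $A\subseteq\mathbb{N}$, $k\in\mathbb{Z}$, and rich if for every $r\in[0,1]$ there is $A\subseteq\mathbb{N}$ with $\delta(A)=r$. $\mathcal{Z}_\delta=\{A\subseteq\mathbb{N}:\delta(A)=0\}$. An ideal on $\mathbb{N}$ is a family $\mathcal{I}\subseteq\mathcal{P}(\mathbb{N})$ closed under finite unions and subsets, containing all finite subsets of $\mathbb{N}$, with $\mathbb{N}\notin\mathcal{I}$; it is translation invariant if $A+k\in\mathcal{I}$ for all $A\in\mathcal{I}$, $k\in\mathbb{Z}$. $\mathcal{I}^+=\{A\subseteq\mathbb{N}:A\notin\mathcal{I}\}$. A family $\mathcal{A}\subseteq\mathcal{P}(\mathbb{N})$ is an $\mathcal{I}$-TAD family if $\mathcal{A}\subseteq\mathcal{I}^+$ and $A\cap(B+k)\in\mathcal{I}$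 for all distinct $A,B\in\mathcal{A}$ and all $k\in\mathbb{Z}$. $\mathfrak{c}$ is the cardinality of the continuum. *)

(* Defs.v *)
(* The set of natural numbers is [nat], with 0. *)
From mathcomp Require Import all_boot all_order all_algebra.
From mathcomp Require Import all_classical all_reals.

Set Implicit Arguments.
Unset Strict Implicit.
Unset Printing Implicit Defensive.

Import Order.TTheory GRing.Theory Num.Theory.

Local Open Scope classical_set_scope.
Local Open Scope ring_scope.

Definition shift (A : set nat) (k : int) : set nat :=
  [set n | exists2 a, A a & n%:Z = a%:Z + k].

Record abstract_upper_density (R : realType) (delta : set nat -> R) : Prop := {
  aud_bounds : forall A, 0 <= delta A <= 1;
  aud_setT : delta setT = 1;
  aud_finite : forall F, finite_set F -> delta F = 0;
  aud_mono : forall A B, A `<=` B -> delta A <= delta B;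
  aud_setU : forall A B, delta (A `|` B) <= delta A + delta B
}.

Definition translation_invariant_density (R : realType)
    (delta : set nat -> R) : Prop :=
  forall (A : set nat) (k : int), delta (shift A k) = delta A.

Definition rich (R : realType) (delta : set nat -> R) : Prop :=
  forall r : R, 0 <= r <= 1 -> exists A, delta A = r.

Definition null_sets (R : realType) (delta : set nat -> R) : set (set nat) :=
  [set A | delta A = 0].

Record ideal (I : set (set nat)) : Prop := {
  ideal_setU : forall A B, I A -> I B -> I (A `|` B);
  ideal_sub : forall A B, A `<=` B -> I B -> I A;
  ideal_finite : forall F, finite_set F -> I F;
  ideal_proper : ~ I setT
}.

Definition translation_invariant_ideal (I : set (set nat)) : Prop :=
  forall (A : set nat) (k : int), I A -> I (shift A k).

Definition positive_sets (I : set (set nat)) : set (set nat) :=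
  [set A | ~ I A].

Definition TAD_family (I F : set (set nat)) : Prop :=
  F `<=` positive_sets I /\
  forall A B, F A -> F B -> A <> B ->
    forall k : int, I (A `&` shift B k).

(* Main.v *)
(* Fix an ultrafilter [U] on the naturals finer than the Fréchet filter, and let
   [delta A] be the limit along [U] of #|A ∩ [0, n)| / n.  This is a finitely
   additive, translation invariant probability, and it extends the asymptotic
   density, hence takes every value in [0, 1].  Additivity makes its null ideal
   c.c.c.: among sets with pairwise null intersections, fewer than n have
   measure greater than 1/n.  So every TAD family, already because of the
   translation k = 0, is countable. *)
Require Import Defs.
From mathcomp Require Import all_boot all_order all_algebra.
From mathcomp Require Import finmap lra zify.
From mathcomp Require Import all_classical all_reals all_analysis.

Set Implicit Arguments.
Unset Strict Implicit.
Unset Printing Implicit Defensive.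

Import Order.TTheory GRing.Theory Num.Theory.
Import numFieldNormedType.Exports.

Local Open Scope classical_set_scope.
Local Open Scope ring_scope.

(** Compactness gives a cluster point [p] of the image of [U]. If the preimage of a neighbourhood of
    [p] were not in [U], its complement would be, and the image would not cluster at [p]. *)
Lemma ultra_cvg_compact (T : Type) (X : ptopologicalType) (U : set_system T)
    (K : set X) (f : T -> X) :
  UltraFilter U -> compact K -> (forall t, K (f t)) -> cvg (f @ U).
Proof.
move=> UU cK fK.
have UK : \forall t \near U, K (f t) by exact: filterE.
have [p [_ clp]] := cK (f @ U) _ UK.
apply/cvg_ex; exists p => V pV.
have [//|UC] := in_ultra_setVsetC (f @^-1` V) UU.
by have [x []] := clp (~` V) V UC pV.
Qed.

(** Countable sets are Lebesgue null, whereas the line has infinite measure. *)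
Lemma uncountable_real (R : realType) : ~ countable [set: R].
Proof.
move=> /countable_lebesgue_measure0.
have -> : [set: R] = [set` `]-oo, +oo[] by rewrite set_itvNyy.
by rewrite lebesgue_measure_itv.
Qed.

(** * Counting functions of sets of naturals *)

Section Counting.
Variable R : realType.
Implicit Types (A B : set nat) (n k : nat).

Definition counting_fun A n : R := \sum_(i < n) (nat_of_ord i \in A)%:R.

(** The translate of [A] by [-k], cut off at 0, written without integers. *)
Definition pullback A k : set nat := [set n | A (n + k)%N].

Lemma counting_fun_ge0 A n : 0 <= counting_fun A n.
Proof. by apply: sumr_ge0 => i _; rewrite ler0n. Qed.

Lemma counting_fun_mono A B n : A `<=` B ->
  counting_fun A n <= counting_fun B n.
Proof.
move=> AB; apply: ler_sum => i _; rewrite ler_nat.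
by case: (boolP (_ \in A)) => // /set_mem/AB/mem_set ->.
Qed.

Lemma counting_funT n : counting_fun setT n = n%:R.
Proof.
by under [LHS]eq_bigr do rewrite in_setT; rewrite sumr_const card_ord.
Qed.

Lemma counting_fun_le A n : counting_fun A n <= n%:R.
Proof. by rewrite -counting_funT; exact: counting_fun_mono. Qed.

Lemma counting_fun0 n : counting_fun set0 n = 0.
Proof. by apply: big1 => i _; rewrite in_set0. Qed.

Lemma counting_funUI A B n :
  counting_fun (A `|` B) n + counting_fun (A `&` B) n =
  counting_fun A n + counting_fun B n.
Proof.
rewrite -!big_split; apply: eq_bigr => i _ /=; rewrite in_setU in_setI.
by case: (_ \in A); case: (_ \in B); rewrite /= ?addr0 ?add0r.
Qed.

Lemma counting_funD A n k :
  counting_fun A (n + k) = counting_fun A k + counting_fun (pullback A k) n.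
Proof.
rewrite /counting_fun addnC big_split_ord /=; congr +%R.
by apply: eq_bigr => i _; rewrite addnC; congr (nat_of_bool _)%:R;
  apply/idP/idP => /set_mem ?; apply/mem_set.
Qed.

(** Splitting [0, n + k) at [k] and at [n] turns the difference into one of two counts over [k]
    positions, each between 0 and [k]. *)
Lemma counting_fun_pullback A n k :
  `|counting_fun (pullback A k) n - counting_fun A n| <= k%:R.
Proof.
have := counting_funD A n k; rewrite addnC counting_funD => e.
have -> : counting_fun (pullback A k) n - counting_fun A n =
          counting_fun (pullback A n) k - counting_fun A k.
  by move: e; lra.
have := counting_fun_ge0 A k; have := counting_fun_le A k.
have := counting_fun_ge0 (pullback A n) k.
have := counting_fun_le (pullback A n) k.
by move=> *; rewrite ler_norml; lra.
Qed.

(* The jumps of n |-> floor (n * r) form a set of asymptotic density r. *)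
Lemma exists_counting_fun_near (r : R) : 0 <= r <= 1 ->
  exists A, forall n, `|counting_fun A n - n%:R * r| <= 1.
Proof.
move=> /andP[r0 r1]; pose t n := Num.truncn (n%:R * r).
have tP n : (t n)%:R <= n%:R * r < (t n).+1%:R.
  by apply: truncn_itv; rewrite mulr_ge0.
exists [set n | t n.+1 != t n] => n.
(* The jumps of [t] telescope from [t 0 = 0]: as 0 <= r <= 1, each increment is 0 or 1, hence equals
   the indicator of a jump. *)
suff -> : counting_fun [set n | t n.+1 != t n] n = (t n)%:R.
  have /andP[] := tP n; rewrite -natr1 => h1 h2.
  by rewrite ler_norml; lra.
elim: n => [|n IHn].
  by rewrite /counting_fun big_ord0 /t mul0r truncn0.
rewrite /counting_fun big_ord_recr /= -/(counting_fun _ n) IHn.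
have -> : (n \in [set n | t n.+1 != t n]) = (t n.+1 != t n).
  by apply/idP/idP => [/set_mem|?]; last exact/mem_set.
have /andP[h1 h2] := tP n; have /andP[h3 h4] := tP n.+1.
have l1 : (t n <= t n.+1)%N.
  rewrite -ltnS -(ltr_nat R); apply: le_lt_trans h4; apply: le_trans h1 _.
  by rewrite -natr1; lra.
have l2 : (t n.+1 <= (t n).+1)%N.
  rewrite -ltnS -(ltr_nat R); apply: (le_lt_trans h3).
  by move: h2; rewrite -!natr1; lra.
rewrite -natrD; congr _%:R.
by case: eqVneq l1 l2 => [->|] /=; lia.
Qed.

End Counting.

(** * The density along an ultrafilter *)

Section UltraDensity.
Variables (R : realType) (U : set_system nat).
Hypotheses (UU : UltraFilter U) (UFrechet : eventually `<=` U).
Implicit Types (A B : set nat) (n k : nat).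

Definition frequency A n : R := counting_fun R A n / n%:R.

Definition ultra_density A : R := lim (frequency A @ U).

Lemma frequency_itv A n : frequency A n \in `[0, 1].
Proof.
rewrite in_itv /= divr_ge0 ?counting_fun_ge0 //=.
(* At n = 0 the frequency is 0, by the convention that the inverse of 0 is 0. *)
case: n => [|n]; first by rewrite /frequency invr0 mulr0.
by rewrite ler_pdivrMr ?ltr0n // mul1r counting_fun_le.
Qed.

Lemma frequency_cvg A : frequency A @ U --> ultra_density A.
Proof.
apply: (@ultra_cvg_compact nat R U `[0, 1] (frequency A)) => //.
  exact: segment_compact.
exact: frequency_itv.
Qed.
Arguments frequency_cvg A : clear implicits.

(** After division by n the error is at most C / n, which vanishes along [U]. A constant [u] serves
    to compute values; the frequency of another set serves for translation invariance. *)
Lemma ultra_density_eq (A : set nat) (u : nat -> R) (l C : R) :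
  u @ U --> l -> (forall n, `|counting_fun R A n - n%:R * u n| <= C) ->
  ultra_density A = l.
Proof.
move=> ul uC; apply: cvg_lim => //.
rewrite -[l]addr0 -[frequency A](subrKC u).
apply: cvgD => //.
(* [harmonic n] is 1 / (n + 1), so [harmonic n.-1] is 1 / n for positive n. *)
have h : (fun n => C * harmonic n.-1) @ U --> (0 : R).
  apply: (@cvg_trans _ ((fun n => C * harmonic n.-1) @ \oo)).
    by move=> V; exact: UFrechet.
  rewrite -[0](mulr0 C); apply: cvgMr.
  rewrite -(@cvg_shiftS R^o (fun n => harmonic n.-1)).
  exact: cvg_harmonic.
apply: norm_cvg0.
apply: (@squeeze_cvgr _ _ _ _ (cst 0) (fun n => C * harmonic n.-1)) => //.
  apply: UFrechet; exists 1%N => // -[|n] // _ /=.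
  rewrite normr_ge0 /= /harmonic /= /frequency.
  have n0 : (0 : R) < n.+1%:R by rewrite ltr0n.
  rewrite ler_pdivlMr // -[X in _ * X](gtr0_norm n0) -normrM.
  rewrite mulrDl mulfVK ?gt_eqF // mulNr mulrC.
  exact: uC.
exact: cvg_cst.
Qed.

Lemma ultra_density_ge0 A : 0 <= ultra_density A.
Proof.
apply: limr_ge; first exact: frequency_cvg.
by apply: filterE => n; have := frequency_itv A n; rewrite in_itv => /andP[].
Qed.

Lemma ultra_densityT : ultra_density setT = 1.
Proof.
apply: (@ultra_density_eq _ (cst 1) _ 0); first exact: cvg_cst.
by move=> n; rewrite counting_funT mulr1 subrr normr0.
Qed.

Lemma ultra_density0 : ultra_density set0 = 0.
Proof.
apply: (@ultra_density_eq _ (cst 0) _ 0); first exact: cvg_cst.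
by move=> n; rewrite counting_fun0 mulr0 subrr normr0.
Qed.

Lemma ultra_density_mono A B : A `<=` B ->
  ultra_density A <= ultra_density B.
Proof.
move=> AB; apply: (ler_cvg_to (frequency_cvg A) (frequency_cvg B)).
by apply: filterE => n; rewrite ler_wpM2r ?invr_ge0 ?ler0n ?counting_fun_mono.
Qed.

Lemma ultra_density_le1 A : ultra_density A <= 1.
Proof. by rewrite -ultra_densityT; apply: ultra_density_mono. Qed.

(** The identity holds for the counts at every n and passes to limits along [U]; an upper limit
    would give only subadditivity. *)
Lemma ultra_densityUI A B :
  ultra_density (A `|` B) + ultra_density (A `&` B) =
  ultra_density A + ultra_density B.
Proof.
have h1 := cvgD (frequency_cvg (A `|` B)) (frequency_cvg (A `&` B)).
have h2 := cvgD (frequency_cvg A) (frequency_cvg B).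
rewrite -(cvg_lim _ (h1 _)) // -(cvg_lim _ (h2 _)) //; congr (lim (_ @ U)).
apply/funext => n.
by rewrite /frequency !fctE -!mulrDl counting_funUI.
Qed.

Lemma ultra_density_setU A B :
  ultra_density (A `|` B) <= ultra_density A + ultra_density B.
Proof. by rewrite -ultra_densityUI lerDl ultra_density_ge0. Qed.

Lemma ultra_density_pullback A k :
  ultra_density (pullback A k) = ultra_density A.
Proof.
apply: (ultra_density_eq (frequency_cvg A) (C := k%:R)) => n.
suff -> : n%:R * frequency A n = counting_fun R A n.
  exact: counting_fun_pullback.
case: n => [|n]; first by rewrite mul0r /counting_fun big_ord0.
by rewrite mulrC mulfVK ?pnatr_eq0.
Qed.

Lemma ultra_density_shift A (k : int) :
  ultra_density (Defs.shift A k) = ultra_density A.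
Proof.
case: k => k.
  rewrite -(ultra_density_pullback _ k); congr ultra_density.
  apply/seteqP; split=> n /=.
    by move=> [a Aa]; rewrite PoszD => /addIr [->].
  by move=> An; exists n.
(* The negative case is the integer -(k + 1), hence a pullback by [k.+1]. *)
rewrite -(ultra_density_pullback A k.+1); congr ultra_density.
apply/seteqP; split=> n /=.
  by move=> [a Aa e]; rewrite /pullback /=; suff -> : (n + k.+1)%N = a by []; lia.
by move=> An; exists (n + k.+1)%N => //; lia.
Qed.

Lemma ultra_density_finite A : finite_set A -> ultra_density A = 0.
Proof.
move=> /finite_fsetP[X ->].
(* Pulling back past the maximum leaves the empty set. *)
pose N := (\max_(i <- X) i).+1.
rewrite -(ultra_density_pullback _ N) -ultra_density0; congr ultra_density.
rewrite -subset0 => n /= nX.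
by have := @leq_bigmax_seq _ (enum_fset X) predT id _ nX isT; rewrite /N /=; lia.
Qed.

Lemma ultra_density_rich : rich ultra_density.
Proof.
move=> r /exists_counting_fun_near[A Ar]; exists A.
by apply: (ultra_density_eq _ Ar); exact: cvg_cst.
Qed.

Lemma ultra_density_aud : abstract_upper_density ultra_density.
Proof.
split.
- by move=> A; rewrite ultra_density_ge0 ultra_density_le1.
- exact: ultra_densityT.
- exact: ultra_density_finite.
- exact: ultra_density_mono.
- exact: ultra_density_setU.
Qed.

(** * Finite additivity and countability of almost disjoint families *)

Lemma ultra_density_bigU (s : seq (set nat)) : uniq s ->
  (forall A B, A \in s -> B \in s -> A <> B -> ultra_density (A `&` B) = 0) ->
  ultra_density (\big[setU/set0]_(A <- s) A) = \sum_(A <- s) ultra_density A.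
Proof.
elim: s => [|A s IHs] /=; first by rewrite !big_nil ultra_density0.
move=> /andP[As us] ad; rewrite !big_cons -IHs //; last first.
  by move=> B C Bs Cs; apply: ad; rewrite in_cons ?Bs ?Cs orbT.
rewrite -ultra_densityUI -[LHS]addr0; congr (_ + _); apply/esym/eqP.
rewrite eq_le ultra_density_ge0 andbT.
have {}ad B : B \in s -> ultra_density (A `&` B) = 0.
  move=> Bs; apply: ad; rewrite ?in_cons ?eqxx ?Bs ?orbT //.
  by move=> AB; rewrite AB Bs in As.
(* By subadditivity, [A] meets the union of the remaining sets in a null set. *)
elim: s {As us IHs} ad => [|B s IHs] ad.
  by rewrite big_nil setI0 ultra_density0.
rewrite big_cons setIUr (le_trans (ultra_density_setU _ _)) //.
rewrite ad ?mem_head // add0r IHs // => C Cs.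
by apply: ad; rewrite in_cons Cs orbT.
Qed.

Lemma almost_disjoint_countable (F : set (set nat)) :
  (forall A, F A -> ultra_density A <> 0) ->
  (forall A B, F A -> F B -> A <> B -> ultra_density (A `&` B) = 0) ->
  countable F.
Proof.
move=> Fpos Fad.
pose G n := [set A | F A /\ n.+1%:R^-1 < ultra_density A].
have -> : F = \bigcup_n G n.
  apply/seteqP; split=> [A FA|A [n _ []] //].
  have /ltr_add_invr[n] : 0 < ultra_density A.
    by rewrite lt_def ultra_density_ge0 andbT; apply/eqP/Fpos.
  by rewrite add0r => An; exists n.
apply: bigcup_countable => // n _; apply: finite_set_countable.
(* Additivity bounds the total measure of [X] by 1, and each member exceeds 1 / (n + 1), so [X] has
   at most n + 1 elements. *)
apply: contrapT => /(infinite_set_fset n.+2)[X XG].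
apply/negP; rewrite -ltnNge ltnS.
have := ultra_density_le1 (\big[setU/set0]_(A <- X) A).
rewrite ultra_density_bigU ?fset_uniq //; last first.
  by move=> A B /XG[FA _] /XG[FB _]; exact: Fad.
move=> le1; rewrite -(ler_nat R).
rewrite -[leRHS]mul1r -ler_pdivrMr ?ltr0n //; apply: le_trans le1.
have -> : #|` X|%:R / n.+1%:R = \sum_(A <- X) (n.+1%:R^-1 : R).
  by rewrite big_const_seq count_predT iter_addr_0 mulr_natl.
rewrite big_seq [leRHS]big_seq; apply: ler_sum => A /XG[_ ]; exact: ltW.
Qed.

End UltraDensity.

(** * The null ideal of the ultrafilter density *)

Theorem theorem3p7 (R : realType) :
  exists I : set (set nat),
    [/\ ideal I,
        translation_invariant_ideal I,
        exists delta : set nat -> R,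
          [/\ abstract_upper_density delta,
              translation_invariant_density delta,
              rich delta &
              null_sets delta = I]
      & ~ exists F : set (set nat),
            TAD_family I F /\ (F #= [set: R])%card].
Proof.
have [U [UU UF]] := @ultraFilterLemma nat eventually _.
pose delta := ultra_density R U; have aud := ultra_density_aud R UU UF.
exists (null_sets delta); split.
- split.
  + move=> A B A0 B0; apply/eqP; rewrite eq_le.
    have /andP[-> _] := aud_bounds aud (A `|` B); rewrite andbT.
    by rewrite (le_trans (aud_setU aud _ _)) // -/delta A0 B0 addr0.
  + move=> A B AB B0; apply/eqP; rewrite eq_le.
    have /andP[-> _] := aud_bounds aud A; rewrite andbT.
    by rewrite (le_trans (aud_mono aud AB)) // -/delta B0.
  + exact: aud_finite aud.
  + by rewrite /null_sets /= aud_setT // => /eqP; rewrite oner_eq0.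
- by move=> A k; rewrite /null_sets /= /delta ultra_density_shift.
- exists delta; split=> //; first exact: ultra_density_shift.
  exact: ultra_density_rich.
(* The case k = 0 of the TAD condition makes [F] countable, so the reals, equinumerous with [F],
   would be countable. *)
move=> [F [[Fpos Fad] FR]]; apply: (@uncountable_real R).
rewrite -(eq_countable FR); apply: (almost_disjoint_countable UU UF Fpos).
move=> A B FA FB AB; have := Fad _ _ FA FB AB 0.
suff -> : Defs.shift B 0 = B by [].
apply/seteqP; split=> n /=; last by exists n; rewrite ?addr0.
by move=> [a Ba]; rewrite addr0 => -[->].
Qed.
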